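(* Let $X\subseteq\mathbb{R}$, $r\in X$, and $f:X\to\mathbb{C}$. The following statements are equivalent: (a) $f$ is continuous at the point $r$. (b) ${}^*f(r+dx)\approx{}^*f(r)$ for all infinitesimals $dx$ with $r+dx\in{}^*X$. (c) ${}^*f(x)\approx{}^*f(r)$ for all $x\in{}^*X$ with $x\approx r$.
   Context: $\mathbb{R}_+$ is the set of positive real numbers and $\mathbb{N}=\{1,2,3,\dots\}$. Fix an ultrafilter $\mathcal{U}$ on $\mathbb{R}_+$ such that $(0,\tfrac1n)\in\mathcal{U}$ for all $n\in\mathbb{N}$. A property of $\varepsilon\in\mathbb{R}_+$ holds almost everywhere (a.e.) if the set of $\varepsilon$ for which it holds belongs to $\mathcal{U}$. For nets $(a_\varepsilon),(b_\varepsilon)\in\mathbb{C}^{\mathbb{R}_+}$ write $(a_\varepsilon)\sim(b_\varepsilon)$ if $a_\varepsilon=b_\varepsilon$ a.e.; $\langle a_\varepsilon\rangle$ is the equivalence class, and ${}^*\mathbb{C}=\mathbb{C}^{\mathbb{R}_+}/\!\sim$ with operations induced pointwise; $\mathbb{C}$ is embedded via constant nets; $|\langle z_\varepsilon\rangle|=\langle|z_\varepsilon|\rangle$. For $S\subseteq\mathbb{C}$, ${}^*S=\{\langle s_\varepsilon\rangle : s_\varepsilon\in S\text{ a.e.}\}$; in particular this defines ${}^*\mathbb{R}$, ordered by $\langle a_\varepsilon\rangle<\langle b_\varepsilon\rangle$ iff $a_\varepsilon<b_\varepsilon$ a.e. For $f:X\to\mathbb{C}$, ${}^*f:{}^*X\to{}^*\mathbb{C}$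 is ${}^*f(\langle x_\varepsilon\rangle)=\langle f(x_\varepsilon)\rangle$, where the representative is chosen with $x_\varepsilon\in X$ for all $\varepsilon$. $z\in{}^*\mathbb{C}$ is infinitesimal if $|z|<\tfrac1n$ for all $n\in\mathbb{N}$; $a\approx b$ means $a-b$ is infinitesimal. Here $dx$ ranges over infinitesimals of ${}^*\mathbb{R}$. Continuity at $r$ is the usual $\varepsilon$-$\delta$ notion relative to $X$. *)

(* Defs.v *)
(* MathComp-Analysis *)
From HB Require Import structures.
From mathcomp Require Import all_boot all_order all_algebra.
From mathcomp Require Import all_classical all_reals all_analysis.
From mathcomp Require Import complex.

Set Implicit Arguments.
Unset Strict Implicit.
Unset Printing Implicit Defensive.

Import Order.TTheory GRing.Theory Num.Theory.
Local Open Scope classical_set_scope.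
Local Open Scope complex_scope.
Local Open Scope quotient_scope.
Local Open Scope ring_scope.

(* R as a subset of C. *)
Definition realline (R : realType) : set R[i] := range (real_complex R).

Section hyper.
Variables (R : realType) (U : set_system {posnum R}) (UU : UltraFilter U).
Local Notation C := R[i].
Local Notation net := ({posnum R} -> C).

(* "Almost everywhere" is the filter quantifier \forall e \near U, _. *)
Definition aeeq (a b : net) : bool := `[< \forall e \near U, a e = b e >].

Lemma aeeq_refl : reflexive aeeq.
Proof. by move=> a; apply/asboolP; near=> e. Unshelve. all: by end_near. Qed.

Lemma aeeq_sym : symmetric aeeq.
Proof.
by move=> a b; apply/asboolP/asboolP; apply: filterS => e.
Qed.

Lemma aeeq_trans : transitive aeeq.
Proof.
move=> b a c /asboolP ab /asboolP bc; apply/asboolP.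
by apply: filterS2 ab bc => e -> ->.
Qed.

Canonical aeeq_equiv := EquivRel aeeq aeeq_refl aeeq_sym aeeq_trans.

(* The type of hypercomplex numbers. *)
Definition hyperC := {eq_quot aeeq}.
HB.instance Definition _ := Choice.on hyperC.
HB.instance Definition _ := EqQuotient.on hyperC.

Definition hclass (a : net) : hyperC := \pi_hyperC a.

Lemma hclassP (a b : net) :
  hclass a = hclass b <-> \forall e \near U, a e = b e.
Proof. by split=> [/eqmodP/asboolP|ab]; last exact/eqmodP/asboolP. Qed.

Lemma hclass_repr (x : hyperC) : hclass (repr x) = x.
Proof. exact: reprK. Qed.

Lemma repr_hclass (a : net) : \forall e \near U, repr (hclass a) e = a e.
Proof. by apply/hclassP; exact: hclass_repr. Qed.

Definition hconst (c : C) : hyperC := hclass (fun=> c).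
Definition hadd (x y : hyperC) : hyperC :=
  hclass (fun e => repr x e + repr y e).
Definition hopp (x : hyperC) : hyperC := hclass (fun e => - repr x e).
Definition habs (x : hyperC) : hyperC := hclass (fun e => `|repr x e|).

Lemma haddE (a b : net) :
  hadd (hclass a) (hclass b) = hclass (fun e => a e + b e).
Proof.
by apply/hclassP; apply: filterS2 (repr_hclass a) (repr_hclass b) => e -> ->.
Qed.

Lemma hoppE (a : net) : hopp (hclass a) = hclass (fun e => - a e).
Proof. by apply/hclassP; apply: filterS (repr_hclass a) => e ->. Qed.

Lemma habsE (a : net) : habs (hclass a) = hclass (fun e => `|a e|).
Proof. by apply/hclassP; apply: filterS (repr_hclass a) => e ->. Qed.

Lemma haddA : associative hadd.
Proof.
move=> x y z; rewrite -(hclass_repr x) -(hclass_repr y) -(hclass_repr z).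
by rewrite !haddE; congr hclass; apply/funext => e; rewrite addrA.
Qed.

Lemma haddC : commutative hadd.
Proof.
move=> x y; rewrite -(hclass_repr x) -(hclass_repr y).
by rewrite !haddE; congr hclass; apply/funext => e; rewrite addrC.
Qed.

Lemma hadd0 : left_id (hconst 0) hadd.
Proof.
move=> x; rewrite -(hclass_repr x) haddE.
by congr hclass; apply/funext => e; rewrite add0r.
Qed.

Lemma haddN : left_inverse (hconst 0) hopp hadd.
Proof.
move=> x; rewrite -(hclass_repr x) hoppE haddE.
by congr hclass; apply/funext => e; rewrite addNr.
Qed.

HB.instance Definition _ :=
  GRing.isZmodule.Build hyperC haddA haddC hadd0 haddN.

Lemma hclassD (a b : net) :
  hclass a + hclass b = hclass (fun e => a e + b e).
Proof. exact: haddE. Qed.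

Lemma hclassB (a b : net) :
  hclass a - hclass b = hclass (fun e => a e - b e).
Proof. by rewrite [- _]hoppE hclassD. Qed.

(* Used only between hyperreals. The order of R[i] relates numbers with equal
   imaginary parts, so on nets that are real almost everywhere this is the
   almost everywhere order of R. *)
Definition hlt (x y : hyperC) : Prop := \forall e \near U, repr x e < repr y e.

Lemma hltE (a b : net) :
  hlt (hclass a) (hclass b) <-> \forall e \near U, a e < b e.
Proof.
split=> ab.
  by apply: filterS3 ab (repr_hclass a) (repr_hclass b) => e h <- <-.
by apply: filterS3 ab (repr_hclass a) (repr_hclass b) => e h -> ->.
Qed.

Definition infinitesimal (z : hyperC) : Prop :=
  forall n : nat, (0 < n)%N -> hlt (habs z) (hconst n%:R^-1).

Definition happrox (x y : hyperC) : Prop := infinitesimal (x - y).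

Definition hset (S : set C) : set hyperC :=
  [set x | exists2 a : net, (\forall e \near U, S (a e)) & x = hclass a].

Definition hyperreal : set hyperC := hset (@realline R).

Section extension.
Variable X : set C.

Lemma hset_rep (x : hset X) :
  exists a : {posnum R} -> X, hclass (fun e => val (a e)) = val x.
Proof.
case: x => x xX /=; move/set_mem: (xX) => [b bX ->].
have [e0 Xe0] := filter_ex bX.
pose x0 : X := exist _ (b e0) (mem_set Xe0).
exists (fun e => insubd x0 (b e)); apply/hclassP.
by apply: filterS bX => e Xe; rewrite val_insubd mem_set.
Qed.

Definition rep_in (x : hset X) : {posnum R} -> X := projT1 (cid (hset_rep x)).

(* The star-extension of f; by hextE it does not depend on the X-valued
   representative chosen. *)
Definition hext (f : X -> C) (x : hset X) : hyperC :=
  hclass (fun e => f (rep_in x e)).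

Lemma hextE (f : X -> C) (x : hset X) (a : {posnum R} -> X) :
  hclass (fun e => val (a e)) = val x -> hext f x = hclass (fun e => f (a e)).
Proof.
rewrite /hext /rep_in; case: cid => b /= <- /hclassP ab.
by apply/hclassP; apply: filterS ab => e /val_inj ->.
Qed.

Lemma hconst_in (r : X) : hconst (val r) \in hset X.
Proof.
apply/mem_set; exists (fun=> val r) => //.
by apply: nearW => _; exact: set_mem (valP r).
Qed.

Definition hpt (r : X) : hset X := exist _ (hconst (val r)) (hconst_in r).

End extension.
End hyper.

Arguments hset {R U UU} S.
Arguments hyperreal {R U UU}.
Arguments hconst {R U} UU c.
Arguments hext {R U UU X} f x.
Arguments hpt {R U} UU {X} r.

Definition continuous_rel (R : realType) (X : set R[i]) (f : X -> R[i])
    (r : X) : Prop :=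
  forall eps : R, 0 < eps -> exists2 delta : R, 0 < delta &
    forall x : X, `|val x - val r| < delta%:C -> `|f x - f r| < eps%:C.

(* Main.v *)
(* In terms of representatives, [a] is infinitely close to [b] when [|a e - b e|]
   is almost everywhere below each standard positive bound, so continuity gives
   (c) bound by bound. If continuity fails for some [eps], picking for every
   index [e] a point of [X] within [e] of [r] whose image is not within [eps] of
   [f r] yields a point of the extension of [X] that contradicts (c), since
   [(0, 1/n)] belongs to [U] for all [n]. *)
Require Import Defs.
From HB Require Import structures.
From mathcomp Require Import all_boot all_order all_algebra.
From mathcomp Require Import all_classical all_reals all_analysis.
From mathcomp Require Import complex.

Set Implicit Arguments.
Unset Strict Implicit.
Unset Printing Implicit Defensive.

Import Order.TTheory GRing.Theory Num.Theory.
Local Open Scope classical_set_scope.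
Local Open Scope complex_scope.
Local Open Scope ring_scope.

(** Since [R] is Archimedean, the bounds [1/n] are cofinal among the positive reals; real bounds
    match the [eps] and [delta] of continuity. *)
Lemma happroxP (R : realType) (U : set_system {posnum R})
    (UU : UltraFilter U) (a b : {posnum R} -> R[i]) :
  happrox (hclass UU a) (hclass UU b) <->
  forall eps : R, 0 < eps -> \forall e \near U, `|a e - b e| < eps%:C.
Proof.
rewrite /happrox /infinitesimal hclassB habsE; split=> [ab eps eps0|ab n n0].
  have /= [n n_eps] := ltr_add_invr eps0; rewrite add0r in n_eps.
  have /hltE := ab n.+1 isT; apply: filterS => e /lt_trans; apply.
  by rewrite -(rmorph_nat (real_complex R)) -fmorphV ltcR.
apply/hltE; rewrite -(rmorph_nat (real_complex R)) -fmorphV; apply: ab.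
by rewrite invr_gt0 ltr0n.
Qed.

Lemma continuous_rel_happrox (R : realType) (U : set_system {posnum R})
    (UU : UltraFilter U) (X : set R[i]) (r : X) (f : X -> R[i]) :
  continuous_rel f r ->
  forall x : hset X, happrox (val x) (hconst UU (val r)) ->
    happrox (hext f x) (hext f (hpt UU r)).
Proof.
move=> fc x; have [a ax] := hset_rep x.
(* The constant net at [r] represents [hpt UU r], so both values become classes of explicit nets. *)
rewrite (hextE f ax) (@hextE _ _ UU _ f (hpt UU r) (fun=> r) erefl) -ax.
move=> /happroxP ar; apply/happroxP => eps /fc [delta delta0 fdelta].
by apply: filterS (ar _ delta0) => e; exact: fdelta.
Qed.

Lemma happrox_continuous_rel (R : realType) (U : set_system {posnum R})
    (UU : UltraFilter U)
    (U0 : forall n : nat, (0 < n)%N ->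
       U [set e : {posnum R} | e%:num < n%:R^-1])
    (X : set R[i]) (r : X) (f : X -> R[i]) :
  (forall x : hset X, happrox (val x) (hconst UU (val r)) ->
    happrox (hext f x) (hext f (hpt UU r))) ->
  continuous_rel f r.
Proof.
move=> fc eps eps0; apply: contrapT => ncont.
have /choice[a aP] (e : {posnum R}) : exists x : X,
    `|val x - val r| < e%:num%:C /\ ~ `|f x - f r| < eps%:C.
  (* If no such point existed, the index [e] itself would serve as [delta] for [eps]. *)
  apply: contrapT => noX; apply: ncont; exists e%:num => // x xr.
  by apply: contrapT => fx; apply: noX; exists x.
have aX : hclass UU (fun e => val (a e)) \in hset X.
  apply/mem_set; exists (fun e => val (a e)) => //.
  by apply: nearW => e; exact: set_mem (valP (a e)).
have ar : happrox (hclass UU (fun e => val (a e))) (hconst UU (val r)).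
  apply/happroxP => d d0.
  have /= [n n_d] := ltr_add_invr d0; rewrite add0r in n_d.
  apply: filterS (U0 n.+1 isT) => e /= e_n.
  by apply: lt_trans (aP e).1 _; rewrite ltcR (lt_trans e_n).
pose x : hset X := exist _ (hclass UU (fun e => val (a e))) aX.
have := fc x ar; rewrite (@hextE _ _ UU _ f x a erefl).
rewrite (@hextE _ _ UU _ f (hpt UU r) (fun=> r) erefl).
(* A set in the proper filter [U] is nonempty, so one index [e] already contradicts the choice of
   [a e]. *)
by move=> /happroxP /(_ _ eps0) /filter_ex [e /(aP e).2].
Qed.

Lemma hyperrealB (R : realType) (U : set_system {posnum R})
    (UU : UltraFilter U) (x y : hyperC UU) :
  hyperreal x -> hyperreal y -> hyperreal (x - y).
Proof.
move=> [a aR ->] [b bR ->]; exists (fun e => a e - b e); last exact: hclassB.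
apply: filterS2 aR bR => e [s _ <-] [t _ <-].
by exists (s - t) => //; rewrite rmorphB.
Qed.

Lemma hset_subset (R : realType) (U : set_system {posnum R})
    (UU : UltraFilter U) (X Y : set R[i]) :
  X `<=` Y -> @hset R U UU X `<=` hset Y.
Proof. by move=> XY _ [a aX ->]; exists a => //; apply: filterS aX => e /XY. Qed.

Theorem theorem4p3p1 (R : realType)
    (U : set_system {posnum R}) (UU : UltraFilter U)
    (U0 : forall n : nat, (0 < n)%N ->
       U [set e : {posnum R} | e%:num < n%:R^-1])
    (X : set R[i]) (XR : X `<=` @realline R) (r : X) (f : X -> R[i]) :
  [<-> continuous_rel f r;
       forall dx : hyperC UU, hyperreal dx -> infinitesimal dx ->
         forall rdxX : (hconst UU (val r) + dx) \in hset X,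
         happrox (hext f (exist _ (hconst UU (val r) + dx) rdxX))
                 (hext f (hpt UU r));
       forall x : hset X, happrox (val x) (hconst UU (val r)) ->
         happrox (hext f x) (hext f (hpt UU r))].
Proof.
tfae.
- move=> fc dx _ dx0 rdxX; apply: continuous_rel_happrox => //=.
  by rewrite /happrox addrC addKr.
- move=> fc [x xX] /= xr.
  (* The increment is [dx = x - r]; it is hyperreal because the extension of [X] lies in that of the
     real line. *)
  have dxR : hyperreal (x - hconst UU (val r)).
    by apply: hyperrealB; apply: (hset_subset XR); apply: set_mem => //;
      exact: hconst_in.
  (* The membership proof is still quantified here, so [r + (x - r)] can be rewritten to [x] in its
     type too. *)
  have := fc _ dxR xr; rewrite subrKC; exact.
- exact: happrox_continuous_rel.
Qed.
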